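(* Let $A$ be a diagonal point configuration with diagonal configurations $A_1,\dots,A_r$. Then $$P_A(t)=P_{A_1}(t_1)\cdots P_{A_r}(t_r),$$ where $t=(t_1,\dots,t_r)$ and $t_j$ denotes the (vector of) variables of the cuspidal form of $A_j$. Here $A$ is written in diagonal form, and if $B_j=\begin{pmatrix} b_j\\ \tilde B_j\end{pmatrix}$ is the Gale dual of $A_j$ used to define $P_{A_j}(t_j)$ (with $b_j$ the row corresponding to the first column of $A_j$), then $P_A(t)$ is defined with the Gale dual $$B=\begin{pmatrix} b_1&b_2&\cdots&b_r\\ \tilde B_1&0&\cdots&0\\ 0&\tilde B_2&\cdots&0\\ \vdots&\vdots&\ddots&\vdots\\ 0&0&\cdots&\tilde B_r\end{pmatrix}$$ of $A$.
   Context: Point configurations and cuspidal form. A point configuration is a real $(1+n)\times N$ matrix $A$ (columns need not be distinct), $n\ge1$, of rank $1+n$ with top row the all ones vector; $m=N-n-1$. Let $\hat A$ be the $n\times N$ matrix obtained by deleting the top row. A Gale dual of $A$ is an $N\times m$ matrix $B$ of rank $m$ with $AB=0$, with rows $\beta_1,\dots,\beta_N$; write $\langle\beta,t\rangle=\sum_i\beta_it_i$. The cuspidal form of $A$ (with respect to $B$) is $$P_A(t)=\sum_{\sigma}|\hat A_\sigma|^2\prod_{k\in\sigma}\langle\beta_k,t\rangle ,$$ the sum over all $n$-element subsets $\sigma\subset\{1,\dots,N\}$, where $|\hat A_\sigma|$ is the determinant of the $n\times n$ submatrix of $\hat A$ with columns in $\sigma$. (If $m=0$, then $P_A=0$.)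 Changing $B$ changes $P_A$ by an invertible linear change of the variables $t$. Diagonal configurations. $A$ is diagonal if, after acting by $\mathrm{GL}_{1+n}(\mathbb{R})$ from the left, it can be written as $$A=\begin{pmatrix}1&1&1&\cdots&1\\0&\tilde A_1&0&\cdots&0\\0&0&\tilde A_2&\cdots&0\\ \vdots&\vdots&\vdots&\ddots&\vdots\\0&0&0&\cdots&\tilde A_r\end{pmatrix},$$ where the first column is a single column, the entries of the top row are (rows of) ones, and $\tilde A_j$ has $n_j\ge1$ rows, $n_1+\dots+n_r=n$. The diagonal configurations of $A$ are $A_j=\begin{pmatrix}1&1\\0&\tilde A_j\end{pmatrix}$, $j=1,\dots,r$. *)

(* Defs.v *)
From mathcomp Require Export all_boot all_order all_algebra.
From mathcomp Require Export reals.
From mathcomp.multinomials Require Export mpoly.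

Set Implicit Arguments.
Unset Strict Implicit.
Unset Printing Implicit Defensive.

Import GRing.Theory.
Local Open Scope ring_scope.

(* Real point configurations, with the row count written as 1 + n so that
   [usubmx A] is the top row and [dsubmx A] is the matrix \hat A. *)
Definition point_configuration (R : realType) (n N : nat)
    (A : 'M[R]_(1 + n, N)) : Prop :=
  [/\ (0 < n)%N, usubmx A = const_mx 1 & \rank A = (1 + n)%N].

(* The dimension condition m = N - n - 1 is written additively to avoid
   truncated subtraction. *)
Definition gale_dual (R : realType) (n N m : nat)
    (A : 'M[R]_(1 + n, N)) (B : 'M[R]_(N, m)) : Prop :=
  [/\ (1 + n + m = N)%N, \rank B = m & A *m B = 0].

(* Columns of M indexed by s, in increasing order; the default value 0 of [nth]
   is never used when #|s| = n. *)
Definition column_submatrix (R : realType) (n N : nat)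
    (M : 'M[R]_(n, N)) (s : {set 'I_N}) : 'M[R]_n :=
  \matrix_(i < n, j < n) nth 0 [seq M i k | k <- enum s] j.

Definition linear_form (R : realType) (m : nat) (b : 'rV[R]_m) : {mpoly R[m]} :=
  \sum_(i < m) b 0 i *: 'X_i.

Definition cuspidal_form (R : realType) (n N m : nat)
    (A : 'M[R]_(1 + n, N)) (B : 'M[R]_(N, m)) : {mpoly R[m]} :=
  \sum_(s : {set 'I_N} | #|s| == n)
    (\det (column_submatrix (dsubmx A) s)) ^+ 2 *:
      \prod_(k in s) linear_form (row k B).

(* The configuration (1 1; 0 M), whose first column is a single column. *)
Definition cone_configuration (R : realType) (n k : nat) (M : 'M[R]_(n, k)) :
    'M[R]_(1 + n, 1 + k) :=
  block_mx (const_mx 1) (const_mx 1) 0 M.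

(* Block-diagonal matrix with rectangular blocks ([mxdiag] only allows square
   ones).  As for [mxdiag], [conform_mx] is used only to retype M j, and it is
   the identity since i = j in that branch. *)
Definition rect_diag (R : realType) (r : nat) (p q : 'I_r -> nat)
    (M : forall j, 'M[R]_(p j, q j)) :
    'M[R]_(\sum_(j < r) p j, \sum_(j < r) q j) :=
  \mxblock_(i < r, j < r) (if i == j then conform_mx 0 (M j) else 0).

Lemma rect_diag_diag (R : realType) (r : nat) (p q : 'I_r -> nat)
    (M : forall j, 'M[R]_(p j, q j)) (j : 'I_r) :
  submxblock (rect_diag M) j j = M j.
Proof. by rewrite mxblockK eqxx conform_mx_id. Qed.

Lemma rect_diag_offdiag (R : realType) (r : nat) (p q : 'I_r -> nat)
    (M : forall j, 'M[R]_(p j, q j)) (i j : 'I_r) :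
  i != j -> submxblock (rect_diag M) i j = 0.
Proof. by move=> /negbTE ne_ij; rewrite mxblockK ne_ij. Qed.

Definition diagonal_configuration (R : realType) (r : nat) (n k : 'I_r -> nat)
    (M : forall j, 'M[R]_(n j, k j)) :
    'M[R]_(1 + \sum_(j < r) n j, 1 + \sum_(j < r) k j) :=
  cone_configuration (rect_diag M).

(* The matrix with first row (b_1 ... b_r) and, below it, the block-diagonal
   matrix of the \tilde B_j, where b_j and \tilde B_j are the first row and the
   remaining rows of B j. *)
Definition diagonal_gale_dual (R : realType) (r : nat) (k m : 'I_r -> nat)
    (B : forall j, 'M[R]_(1 + k j, m j)) :
    'M[R]_(1 + \sum_(j < r) k j, \sum_(j < r) m j) :=
  col_mx (\mxrow_(j < r) usubmx (B j)) (rect_diag (fun j => dsubmx (B j))).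

(* p(t_j) as a polynomial in t = (t_1, ..., t_r): [tagnat.Rank j i] is the
   position of the i-th entry of t_j in the concatenated vector t, which is the
   column indexing used by [mxrow] and [mxblock]. *)
Definition in_block_variables (R : realType) (r : nat) (m : 'I_r -> nat)
    (j : 'I_r) (p : {mpoly R[m j]}) : {mpoly R[\sum_(l < r) m l]} :=
  comp_mpoly [tuple 'X_(tagnat.Rank j i) | i < m j] p.

(* Main.v *)
(* By the Cauchy-Binet formula, P_A(t) is the determinant of
   \hat A diag(<beta_1, t>, ..., <beta_N, t>) \hat A^T.  When A is in diagonal
   form, the first column of \hat A vanishes and the rest is block diagonal, so
   this matrix is block diagonal, with the matrices of the A_j as its blocks. *)
From HB Require Import structures.
Require Import Defs.
From mathcomp Require Import fingroup perm.

Set Implicit Arguments.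
Unset Strict Implicit.
Unset Printing Implicit Defensive.

Import GRing.Theory.
Local Open Scope ring_scope.

(** Trades list-based selection of columns for an injective indexing [e] of [s], the same for every
    [f] and every default [z]. *)
Lemma set_nth_enum (T : finType) (n : nat) (s : {set T}) : #|s| = n ->
  exists e : 'I_n -> T, [/\ injective e, e @: [set: 'I_n] = s &
    forall (V : Type) (z : V) (f : T -> V) (j : 'I_n),
      nth z [seq f k | k <- enum s] j = f (e j)].
Proof.
move=> <-; exists (@enum_val _ (mem s)); split.
- exact: enum_val_inj.
- apply/setP=> x; apply/imsetP/idP => [[i _ ->]|xs]; first exact: enum_valP.
  by exists (enum_rank_in xs x); rewrite ?inE ?enum_rankK_in.
- move=> V z f j.
  (* The index [j] shows that [T] is inhabited, giving the default that [nth_map] requires. *)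
  have x0 : T by apply: (enum_val j).
  by rewrite (nth_map x0) -?cardE // -(enum_val_nth x0).
Qed.

(** * The Cauchy-Binet formula *)

Section CauchyBinet.

Variables (R : comPzRingType) (n N : nat).
Variables (A : 'M[R]_(n, N)) (B : 'M[R]_(N, n)).

(** In the Leibniz formula, distributing the product over the entry sums chooses a summation index
    [f i] for each row [i]; for fixed [f], the signed sum over permutations is a determinant of rows
    of [B]. *)
Lemma det_mulmx_sum_ffun :
  \det (A *m B) = \sum_(f : {ffun 'I_n -> 'I_N})
    (\prod_i A i (f i)) * \det (rowsub f B).
Proof.
rewrite /determinant.
transitivity (\sum_(s : 'S_n) \sum_(f : {ffun 'I_n -> 'I_N})
    (-1) ^+ s * \prod_i (A i (f i) * B (f i) (s i))).
  apply: eq_bigr => s _; rewrite -big_distrr /=; congr (_ * _).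
  rewrite -(bigA_distr_bigA (fun i k => A i k * B k (s i))) /=.
  by apply: eq_bigr => i _; rewrite mxE.
rewrite exchange_big; apply: eq_bigr => f _ /=; rewrite big_distrr /=.
apply: eq_bigr => s _; rewrite big_split /= mulrCA; congr (_ * (_ * _)).
by apply: eq_bigr => i _; rewrite mxE.
Qed.

(** The maps summed over are exactly the composites of [e] with a permutation [s]; reordering the
    rows of [B] yields the sign of [s], which completes the Leibniz formula for the minor of [A]. *)
Lemma sum_ffun_image (e : 'I_n -> 'I_N) : injective e ->
  \sum_(f : {ffun 'I_n -> 'I_N} | injectiveb f &&
       (f @: [set: 'I_n] == e @: [set: 'I_n]))
    (\prod_i A i (f i)) * \det (rowsub f B) =
  \det (colsub e A) * \det (rowsub e B).
Proof.
move=> e_inj.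
pose to (s : 'S_n) : {ffun 'I_n -> 'I_N} := [ffun i => e (s i)].
(* The inverse of [to] finds the position of [f i] in [e]; the defaults [i] and [1] are never
   reached when [f] is injective with the image of [e]. *)
pose g (f : {ffun 'I_n -> 'I_N}) := [ffun i => odflt i [pick j | e j == f i]].
pose of_ f : 'S_n := insubd (1%g : 'S_n) (g f).
rewrite (reindex to) /=; last first.
  exists of_ => [s _ | f].
    apply/permP => i; rewrite /of_ -pvalE insubdK; last first.
      apply/injectiveP => i1 i2; rewrite !ffunE.
      case: pickP => [j1|/(_ (s i1))]; rewrite ?eqxx // => /eqP /e_inj ->.
      case: pickP => [j2|/(_ (s i2))]; rewrite ?eqxx // => /eqP /e_inj ->.
      exact: perm_inj.
    rewrite !ffunE; case: pickP => [j|/(_ (s i))]; rewrite ?eqxx //.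
    by move=> /eqP /e_inj ->.
  rewrite inE => /andP[/injectiveP f_inj /eqP im_f].
  have g_f i : e (g f i) = f i.
    rewrite ffunE; case: pickP => [j /eqP //|no_j].
    have : f i \in e @: [set: 'I_n] by rewrite -im_f imset_f ?inE.
    by case/imsetP => j _ fi; have := no_j j; rewrite fi eqxx.
  apply/ffunP => i; rewrite ffunE /of_ -pvalE insubdK ?g_f //.
  by apply/injectiveP => i1 i2 eq_g; apply: f_inj; rewrite -!g_f eq_g.
rewrite [in RHS]/determinant big_distrl /=.
apply: eq_big => [s | s _].
  apply/andP; split.
    by apply/injectiveP => i j; rewrite !ffunE => /e_inj /perm_inj.
  apply/eqP/setP => x; apply/imsetP/imsetP => [] [i _ ->].
    by exists (s i); rewrite ?inE ?ffunE.
  by exists ((s^-1)%g i); rewrite ?inE // ffunE permKV.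
have -> : rowsub (to s) B = perm_mx s *m rowsub e B.
  by rewrite -row_permE; apply/matrixP => i j; rewrite !mxE ffunE.
rewrite det_mulmx det_perm mulrA [_ * (-1) ^+ s]mulrC; congr (_ * _ * _).
by apply: eq_bigr => i _; rewrite mxE ffunE.
Qed.

Theorem cauchy_binet :
  \det (A *m B) = \sum_(s : {set 'I_N} | #|s| == n)
    \det (\matrix_(i < n, j < n) nth 0 [seq A i k | k <- enum s] j) *
    \det (\matrix_(i < n, j < n) nth 0 [seq B k j | k <- enum s] i).
Proof.
rewrite det_mulmx_sum_ffun (bigID (fun f : {ffun _} => injectiveb f)) /=.
(* A non-injective [f] repeats a row of [B], so its determinant vanishes; the injective ones are
   then grouped by image. *)
rewrite [X in _ + X]big1 ?addr0; last first.
  move=> f /injectivePn[i1 [i2 ne_i eq_f]].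
  by rewrite (determinant_alternate ne_i) ?mulr0 // => j; rewrite !mxE eq_f.
rewrite (partition_big (fun f : {ffun 'I_n -> 'I_N} => f @: [set: 'I_n])
          (fun s => #|s| == n)) /=; last first.
  by move=> f /injectiveP f_inj; rewrite card_imset // cardsT card_ord.
apply: eq_bigr => s /eqP /set_nth_enum[e [e_inj im_e nth_e]].
rewrite -{1}im_e sum_ffun_image //.
by congr (_ * _); congr (\det _); apply/matrixP => i j; rewrite !mxE nth_e.
Qed.

End CauchyBinet.

(** * Block-diagonal matrices *)

Lemma det_mxdiag (R : comPzRingType) (r : nat) (p : 'I_r -> nat)
    (D : forall j, 'M[R]_(p j)) :
  \det (\mxdiag_j D j) = \prod_j \det (D j).
Proof.
elim: r p D => [|r IHr] p D.
  by move: (\mxdiag_j D j); rewrite big_ord0 => M; rewrite det_mx00 big_ord0.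
(* Splitting off the first block changes the type of the size, hence a cast. *)
have det_castmx a b (E : a = b) (M : 'M[R]_a) : \det (castmx (E, E) M) = \det M.
  by case: _ / E; rewrite castmx_id.
by rewrite mxdiag_recl det_castmx det_ublock IHr big_ord_recl.
Qed.

(* [rect_diag] over an arbitrary ring; it is needed over polynomial rings. *)
Definition mxrect_diag (V : nmodType) (r : nat) (p q : 'I_r -> nat)
    (M : forall j, 'M[V]_(p j, q j)) :
    'M[V]_(\sum_(j < r) p j, \sum_(j < r) q j) :=
  \mxblock_(i < r, j < r) (if i == j then conform_mx 0 (M j) else 0).

Lemma mxdiagE (V : nmodType) (r : nat) (p : 'I_r -> nat)
    (D : forall j, 'M[V]_(p j)) :
  \mxdiag_j D j = mxrect_diag D.
Proof. by apply/eq_mxblock => i j; case: eqVneq => [->|]. Qed.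

Lemma tr_mxrect_diag (V : nmodType) (r : nat) (p q : 'I_r -> nat)
    (M : forall j, 'M[V]_(p j, q j)) :
  (mxrect_diag M)^T = mxrect_diag (fun j => (M j)^T).
Proof.
rewrite /mxrect_diag tr_mxblock; apply/eq_mxblock => i j.
by case: eqVneq => [->|]; rewrite ?conform_mx_id ?trmx0.
Qed.

Lemma map_mxrect_diag (V W : nmodType) (f : {additive V -> W}) (r : nat)
    (p q : 'I_r -> nat) (M : forall j, 'M[V]_(p j, q j)) :
  map_mx f (mxrect_diag M) = mxrect_diag (fun j => map_mx f (M j)).
Proof.
transitivity (\mxblock_(i < r, j < r)
    map_mx f (if i == j then conform_mx 0 (M j) else 0 : 'M_(p i, q j))).
  by apply/matrixP => i j; rewrite !mxE.
apply/eq_mxblock => i j.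
by case: eqVneq => [->|_]; rewrite ?conform_mx_id ?map_mx0.
Qed.

Lemma mul_mxrect_diag (R : pzSemiRingType) (r : nat) (p q u : 'I_r -> nat)
    (M : forall j, 'M[R]_(p j, q j)) (M' : forall j, 'M[R]_(q j, u j)) :
  mxrect_diag M *m mxrect_diag M' = mxrect_diag (fun j => M j *m M' j).
Proof.
rewrite /mxrect_diag mul_mxblock; apply/eq_mxblock => i j.
rewrite (bigD1 i) //= eqxx conform_mx_id big1 ?addr0 => [|l ne_l]; last first.
  by rewrite eq_sym (negPf ne_l) mul0mx.
by case: eqVneq => [->|_]; rewrite ?conform_mx_id ?mulmx0.
Qed.

Lemma mul_mxrect_diag_mxcol (R : pzSemiRingType) (r c : nat) (p q : 'I_r -> nat)
    (M : forall j, 'M[R]_(p j, q j)) (C : forall j, 'M[R]_(q j, c)) :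
  mxrect_diag M *m \mxcol_j C j = \mxcol_j (M j *m C j).
Proof.
rewrite /mxrect_diag mul_mxblock_mxrow; apply/eq_mxcol => i.
rewrite (bigD1 i) //= eqxx conform_mx_id big1 ?addr0 // => l ne_l.
by rewrite eq_sym (negPf ne_l) mul0mx.
Qed.

Lemma mul_mxrow_mxrect_diag (R : pzSemiRingType) (r c : nat)
    (p q : 'I_r -> nat)
    (C : forall j, 'M[R]_(c, p j)) (M : forall j, 'M[R]_(p j, q j)) :
  \mxrow_j C j *m mxrect_diag M = \mxrow_j (C j *m M j).
Proof.
rewrite /mxrect_diag mul_mxrow_mxblock; apply/eq_mxrow => i.
rewrite (bigD1 i) //= eqxx conform_mx_id big1 ?addr0 // => l ne_l.
by rewrite (negPf ne_l) mulmx0.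
Qed.

(** * The cuspidal form as a determinant *)

Section CuspidalDeterminant.

Variable R : realType.

(** Written as the matrix product of [B] with the vector of variables, so that block computations
    apply. *)
Definition linear_forms (N m : nat) (B : 'M[R]_(N, m)) : 'cV[{mpoly R[m]}]_N :=
  map_mx (@mpolyC m R) B *m \col_i 'X_i.

Lemma linear_formsE (N m : nat) (B : 'M[R]_(N, m)) (k : 'I_N) :
  linear_forms B k 0 = linear_form (row k B).
Proof.
by rewrite mxE; apply: eq_bigr => i _; rewrite !mxE mul_mpolyC.
Qed.

Definition cuspidal_matrix (n N m : nat) (M : 'M[R]_(n, N))
    (B : 'M[R]_(N, m)) : 'M[{mpoly R[m]}]_n :=
  map_mx (@mpolyC m R) M *m diag_mx (linear_forms B)^T
    *m (map_mx (@mpolyC m R) M)^T.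

(** In Cauchy-Binet, the diagonal factor multiplies the second minor by the linear forms indexed by
    [s]; the two minors of [dsubmx A] are transposes of each other and give the square. *)
Lemma cuspidal_form_det (n N m : nat) (A : 'M[R]_(1 + n, N))
    (B : 'M[R]_(N, m)) :
  cuspidal_form A B = \det (cuspidal_matrix (dsubmx A) B).
Proof.
rewrite /cuspidal_matrix -mulmxA cauchy_binet.
apply: eq_bigr => s /eqP /set_nth_enum[e [e_inj im_e nth_e]].
set M := column_submatrix _ s.
have -> : \matrix_(i < n, j < n)
    nth 0 [seq map_mx (@mpolyC m R) (dsubmx A) i k | k <- enum s] j =
  map_mx (@mpolyC m R) M.
  by apply/matrixP => i j; rewrite !(mxE, nth_e).
set d := (linear_forms B)^T.
have -> : \matrix_(i < n, j < n)
    nth 0 [seq (diag_mx d *m (map_mx (@mpolyC m R) (dsubmx A))^T) k j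
              | k <- enum s] i =
  diag_mx (colsub e d) *m (map_mx (@mpolyC m R) M)^T.
  by apply/matrixP => i j; rewrite !mul_diag_mx !(mxE, nth_e).
rewrite det_mulmx det_diag det_tr det_map_mx mulrCA -mpolyCM -expr2.
rewrite mulrC mul_mpolyC; congr (_ *: _).
(* The product over [s] is reindexed along [e] to match the determinant of the diagonal matrix. *)
rewrite -im_e big_imset /=; last by move=> i j _ _ /e_inj.
rewrite (eq_bigl xpredT); last by move=> i; rewrite inE.
by apply: eq_bigr => i _; rewrite [RHS]mxE mxE linear_formsE.
Qed.

(** The zero column annihilates the first linear form, so only [dsubmx B] remains. *)
Lemma cuspidal_matrix_row0 (n N m : nat) (M : 'M[R]_(n, N))
    (B : 'M[R]_(1 + N, m)) :
  cuspidal_matrix (row_mx 0 M) B = cuspidal_matrix M (dsubmx B).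
Proof.
rewrite /cuspidal_matrix map_row_mx map_mx0.
have -> : (linear_forms B)^T =
    row_mx (linear_forms (usubmx B))^T (linear_forms (dsubmx B))^T.
  by rewrite -tr_col_mx /linear_forms -mul_col_mx -map_col_mx vsubmxK.
rewrite diag_mx_row tr_row_mx mul_row_block mul_row_col.
by rewrite trmx0 !mul0mx !mulmx0 !add0r.
Qed.

Lemma cuspidal_form_cone (n N m : nat) (M : 'M[R]_(n, N))
    (B : 'M[R]_(1 + N, m)) :
  cuspidal_form (cone_configuration M) B =
    \det (cuspidal_matrix M (dsubmx B)).
Proof.
rewrite cuspidal_form_det /cone_configuration /block_mx col_mxKd.
by rewrite cuspidal_matrix_row0.
Qed.

(** As a ring morphism, the change of variables commutes with matrix products and determinants. *)
HB.instance Definition _ (r : nat) (m : 'I_r -> nat) (j : 'I_r) :=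
  GRing.RMorphism.copy (@in_block_variables R r m j)
    (comp_mpoly [tuple 'X_(tagnat.Rank j i) | i < m j]).

(** All three factors are block diagonal, and the linear forms from block [j] involve only the
    variables [t_j]. *)
Lemma cuspidal_matrix_rect_diag (r : nat) (n k m : 'I_r -> nat)
    (M : forall j, 'M[R]_(n j, k j)) (B : forall j, 'M[R]_(k j, m j)) :
  cuspidal_matrix (rect_diag M) (rect_diag B) =
    \mxdiag_j map_mx (@in_block_variables R r m j)
      (cuspidal_matrix (M j) (B j)).
Proof.
pose X j : 'cV[{mpoly R[\sum_(l < r) m l]}]_(m j) :=
  \col_i 'X_(tagnat.Rank j i).
pose C := @mpolyC (\sum_(l < r) m l) R.
have colX : \col_i 'X_i = \mxcol_j X j.
  by apply/mxcolP => j; rewrite mxcolK; apply/matrixP => i l; rewrite !mxE.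
have forms : linear_forms (rect_diag B) = \mxcol_j (map_mx C (B j) *m X j).
  by rewrite /linear_forms map_mxrect_diag colX mul_mxrect_diag_mxcol.
rewrite /cuspidal_matrix forms tr_mxcol diag_mxrow.
rewrite map_mxrect_diag tr_mxrect_diag.
rewrite mxdiagE !mul_mxrect_diag -mxdiagE; apply/eq_mxdiag => j.
have mapC p q (D : 'M_(p, q)) :
    map_mx (@in_block_variables R r m j) (map_mx (@mpolyC (m j) R) D) =
    map_mx C D.
  by apply/matrixP => a b; rewrite !mxE /in_block_variables comp_mpolyC.
rewrite !map_mxM -map_trmx mapC; congr (_ *m _ *m _).
rewrite map_diag_mx -map_trmx map_mxM mapC; congr (diag_mx (_ *m _)^T).
(* The substitution sends the variable of index [a] to the one at position [tagnat.Rank j a]. *)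
apply/matrixP => a b; rewrite !mxE [RHS]comp_mpolyXU.
by rewrite -tnth_nth tnth_mktuple.
Qed.

End CuspidalDeterminant.

(** * The Gale dual of a diagonal configuration *)

Section DiagonalGaleDual.

Variable R : realType.

Lemma cone_mul_eq0 (n N m : nat) (M : 'M[R]_(n, N)) (B : 'M[R]_(1 + N, m)) :
  cone_configuration M *m B = 0 <->
  usubmx B = - (const_mx 1 *m dsubmx B) /\ M *m dsubmx B = 0.
Proof.
rewrite -[B in _ *m B]vsubmxK mul_block_col mul0mx add0r.
have -> : const_mx 1 = 1%:M :> 'M[R]_1.
  by apply/matrixP => i j; rewrite !mxE !ord1.
rewrite mul1mx -[0]vsubmxK !linear0; split.
  by case/eq_col_mx => /eqP; rewrite addr_eq0 => /eqP ->.
by case=> -> ->; rewrite addNr.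
Qed.

(* The first row of B_j is a combination of the others, so deleting it keeps
   the columns independent. *)
Lemma gale_dual_left_inverse (n N m : nat) (M : 'M[R]_(n, N))
    (B : 'M[R]_(1 + N, m)) :
  gale_dual (cone_configuration M) B -> exists L, L *m dsubmx B = 1%:M.
Proof.
case=> _ rkB /cone_mul_eq0[topB _].
have /row_fullP[L LB] : row_full B by rewrite /row_full rkB.
(* The second factor rebuilds [B] from [dsubmx B], and [L] is a left inverse of [B]. *)
exists (L *m col_mx (- const_mx 1) 1%:M).
by rewrite -mulmxA mul_col_mx mulNmx mul1mx -topB vsubmxK.
Qed.

Lemma gale_dual_diagonal (r : nat) (n k m : 'I_r -> nat)
    (M : forall j, 'M[R]_(n j, k j)) (B : forall j, 'M[R]_(1 + k j, m j)) :
  (forall j, gale_dual (cone_configuration (M j)) (B j)) ->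
  gale_dual (diagonal_configuration M) (diagonal_gale_dual B).
Proof.
move=> hB; split.
(* Each block satisfies [n j + m j = k j] once the leading 1 is cancelled; these equalities add
   up. *)
- rewrite -addnA -big_split /=; congr (1 + _)%N; apply: eq_bigr => j _.
  by have [+ _ _] := hB j; rewrite -addnA => /addnI.
- have /fin_all_exists[L LB] : forall j, exists L, L *m dsubmx (B j) = 1%:M.
    by move=> j; apply: gale_dual_left_inverse (hB j).
  apply/eqP; rewrite -[_ == _]/(row_full _); apply/row_fullP.
  (* The zero column discards the row of the [b_j], and the blocks of [L] invert the remaining
     blocks on the left, which gives full column rank. *)
  exists (row_mx 0 (mxrect_diag L)).
  rewrite mul_row_col mul0mx add0r mul_mxrect_diag -mxdiagZ -mxdiagE.
  exact/eq_mxdiag.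
- apply/cone_mul_eq0; rewrite col_mxKu col_mxKd mul_mxrect_diag; split.
    rewrite -mxrow_const mul_mxrow_mxrect_diag -mxrowN; apply/eq_mxrow => j.
    by have [_ _ /cone_mul_eq0[]] := hB j.
  rewrite -[0]mxblock0; apply/eq_mxblock => i j; case: eqVneq => [->|//].
  by have [_ _ /cone_mul_eq0[_ ->]] := hB j; rewrite conform_mx_id.
Qed.

End DiagonalGaleDual.

Theorem theorem4p5 (R : realType) (r : nat) (n k m : 'I_r -> nat)
    (hn : forall j, (0 < n j)%N)
    (Atilde : forall j, 'M[R]_(n j, k j))
    (hA : point_configuration (diagonal_configuration Atilde))
    (B : forall j, 'M[R]_(1 + k j, m j))
    (hB : forall j, gale_dual (cone_configuration (Atilde j)) (B j)) :
  gale_dual (diagonal_configuration Atilde) (diagonal_gale_dual B) /\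
  cuspidal_form (diagonal_configuration Atilde) (diagonal_gale_dual B) =
    \prod_(j < r)
      in_block_variables
        (cuspidal_form (cone_configuration (Atilde j)) (B j)).
Proof.
split; first exact: gale_dual_diagonal.
rewrite cuspidal_form_cone col_mxKd cuspidal_matrix_rect_diag det_mxdiag.
by apply: eq_bigr => j _; rewrite cuspidal_form_cone det_map_mx.
Qed.
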